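(* Assume that the small-ball assumption holds with constants $\kappa,\delta>0$, i.e. for every $h\in\mathbb H$, $\mathbb P\big(|\langle X,h\rangle|\ge \kappa\|\langle h,X\rangle\|_{L_2(\mu)}\big)\ge\delta$. Set $\gamma=\kappa\delta/32$. Then there is an event of probability at least $1-2\exp(-\delta^2 n/16)$ on which $$\|\langle X,\hat h-h^*\rangle\|_{L_2(\mu)}\le \max\Big\{\frac{\sqrt 8}{\kappa\sqrt\delta}\,\frac{\|\xi\|_2}{\sqrt n},\ r^*(\gamma)\big(2\|h^*\|+\|\hat\nu\|\big)\Big\}.$$ Moreover, if there exists $\zeta>0$ such that $\Delta(\gamma,h^* )\ge\zeta$, then on the same event $$\|\langle X,\hat h-h^*\rangle\|_{L_2(\mu)}\le \max\Big\{\frac{\sqrt 8}{\kappa\sqrt\delta}\,\frac{\|\xi\|_2}{\sqrt n},\ \frac{r^*(\gamma)\|\hat\nu\|}{\zeta}\Big\}.$$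
   Context: $\mathbb H$ is a (real) Hilbert space with inner product $\langle\cdot,\cdot\rangle$, and $\|\cdot\|$ is a norm defined on $\mathbb H$. Observations $(Y_i,X_i)_{i=1}^n$ satisfy $Y_i=\langle X_i,h^*\rangle+\xi_i$, where $h^*\in\mathbb H$ is the unknown parameter, $X_1,\dots,X_n$ are i.i.d. random elements of $\mathbb H$ with distribution $\mu$, and $\xi=(\xi_1,\dots,\xi_n)\in\mathbb R^n$ is an arbitrary error vector (deterministic, random, or depending adversarially on the $X_i$ and $h^*$). $\|\xi\|_2$ is the Euclidean norm. $X$ denotes an independent copy of $X_1$, and for $h\in\mathbb H$, $\|\langle X,h\rangle\|_{L_2(\mu)}^2:=\int\langle h,x\rangle^2\,d\mu(x)$ (when $h$ is data-dependent, the integral is over $x$ only). Minimum norm interpolator: $\hat h$ is a minimizer of $\|h\|$ over $h\in\mathbb H$ subject to $\langle X_i,h\rangle=Y_i$ for all $i$. Interpolated noise: $\hat\nu$ is a minimizer of $\|h\|$ over $h\in\mathbb H$ subject to $\langle X_i,h\rangle=\xi_i$ for all $i$. Both minimizers are assumed to exist. Local Rademacher complexity: with $B=\{h\in\mathbb H:\|h\|\le1\}$ and $\varepsilon_1,\dots,\varepsilon_n$ i.i.d. Rademacher variables independent of the $X_i$, $$r^*(\gamma)=\inf\Big\{r>0:\ \mathbb E\sup_{h\in B:\ \|\langle X,h\rangle\|_{L_2(\mu)}\le r}\ \sum_{i=1}^n\varepsilon_i\langle X_i,h\rangle\le\gamma n r\Big\}.$$ Subdifferential quantity: let $\|g\|^*=\sup_{\|x\|\le1}\langle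 g,x\rangle$ be the dual norm, $S^*=\{g\in\mathbb H:\|g\|^*=1\}$, $\partial(\|\cdot\|)_{h^*}=\{g\in S^*:\langle g,h^*\rangle=\|h^*\|\}$, and $H_{r,\gamma}=\{h\in\mathbb H:\|\langle X,h\rangle\|_{L_2(\mu)}\le r^*(\gamma),\ \|h\|=1\}$. Then $$\Delta(\gamma,h^* )=\inf_{h\in H_{r,\gamma}}\ \sup_{g\in\partial(\|\cdot\|)_{h^*}}\langle g,h\rangle.$$ *)

(* Defs.v *)
From HB Require Import structures.
From mathcomp Require Import all_boot all_order all_algebra.
From mathcomp Require Import sesquilinear.
From mathcomp Require Import all_classical all_reals all_analysis.

Set Implicit Arguments.
Unset Strict Implicit.
Unset Printing Implicit Defensive.
Import Order.TTheory GRing.Theory Num.Theory.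
Import numFieldNormedType.Exports.

Local Open Scope classical_set_scope.
Local Open Scope ring_scope.

(* A real Hilbert space is a completeNormedModType H over a realType R together
   with a dot product [dot : {dot H for @idfun R}] (symmetric, bilinear and
   positive definite) that induces the canonical norm `|_| of H. The other norm
   of the problem, the one that is minimized, is a function [N : H -> R]; it
   need not be equivalent to `|_|. *)
Definition dot_induces_norm (R : realType) (H : completeNormedModType R)
    (dot : {dot H for @idfun R}) : Prop :=
  forall h : H, `|h| ^+ 2 = dot h h.

Record is_norm (R : realType) (H : lmodType R) (N : H -> R) : Prop := IsNorm {
  norm_triangle : forall x y, N (x + y) <= N x + N y ;
  norm_homogeneous : forall (a : R) x, N (a *: x) = `|a| * N x ;
  norm_definite : forall x, N x = 0 -> x = 0 }.

Definition borel (R : realType) (H : completeNormedModType R) :=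
  g_sigma_algebraType (@open H).

(* Laws of random elements of H in the strong (Bochner) sense: the law lives on
   a separable closed set. Every Borel law on a separable H has this property;
   it makes the suprema over subsets of H below almost surely equal to
   measurable functions. *)
Definition separable_law (R : realType) (H : completeNormedModType R)
    (mu : probability (borel H) R) : Prop :=
  exists2 D : set H, countable D & mu (closure D) = 1%E.

Definition identically_distributed (R : realType) (d d' : measure_display)
    (Omega : measurableType d) (T : measurableType d')
    (P : probability Omega R) (mu : probability T R)
    (n : nat) (X : 'I_n -> {RV P >-> T}) : Prop :=
  forall (i : 'I_n) (A : set T), measurable A -> distribution P (X i) A = mu A.

Definition mutually_independent (R : realType) (d d' : measure_display)
    (Omega : measurableType d) (T : measurableType d')
    (P : probability Omega R) (n : nat) (X : 'I_n -> {RV P >-> T}) : Prop :=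
  forall (J : {set 'I_n}) (A : 'I_n -> set T),
    (forall i, measurable (A i)) ->
    P (\bigcap_(i in [set` J]) (X i @^-1` A i)) =
      (\prod_(i in J) P (X i @^-1` A i))%E.

Definition L2norm (R : realType) (H : completeNormedModType R)
    (dot : {dot H for @idfun R}) (mu : probability (borel H) R) (h : H) :
    \bar R :=
  Lnorm mu 2%:E (fun x : borel H => (dot x h)%:E).

(* No finiteness of the L2 norm is assumed: the small-ball condition entails it,
   since the event below is empty when the L2 norm of h is +oo. *)
Definition small_ball (R : realType) (H : completeNormedModType R)
    (dot : {dot H for @idfun R}) (mu : probability (borel H) R)
    (kappa delta : R) : Prop :=
  forall h : H, (delta%:E <=
    mu [set x : borel H |
         (kappa%:E * L2norm dot mu h <= `|dot x h|%:E)%E])%E.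

Definition is_min_norm_solution (R : realType) (H : completeNormedModType R)
    (dot : {dot H for @idfun R}) (N : H -> R) (n : nat)
    (x : 'I_n -> H) (y : 'I_n -> R) (h : H) : Prop :=
  (forall i, dot (x i) h = y i) /\
  (forall h' : H, (forall i, dot (x i) h' = y i) -> N h <= N h').

Definition euclidean_norm (R : realType) (n : nat) (v : 'I_n -> R) : R :=
  Num.sqrt (\sum_(i < n) v i ^+ 2).

(* i.i.d. Rademacher signs form a uniform element of {-1, 1}^n; a sign vector is
   encoded by s : {ffun 'I_n -> bool}, its i-th sign being (-1) ^+ s i. *)
Definition rademacher_mean (R : realType) (n : nat) (F : ('I_n -> R) -> \bar R) :
    \bar R :=
  ((2 ^- n)%:E *
    \sum_(s : {ffun 'I_n -> bool}) F (fun i => ((-1) ^+ s i)%R))%E.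

(* As the signs are independent of the X_i, the expectation is the integral over
   the X_i of the mean over the signs. *)
Definition local_rademacher (R : realType) (H : completeNormedModType R)
    (dot : {dot H for @idfun R}) (N : H -> R) (mu : probability (borel H) R)
    (d : measure_display) (Omega : measurableType d) (P : probability Omega R)
    (n : nat) (X : 'I_n -> {RV P >-> borel H}) (r : R) : \bar R :=
  (\int[P]_w rademacher_mean (fun eps : 'I_n -> R =>
     ereal_sup [set (\sum_(i < n) eps i * dot (X i w) h)%R%:E |
                h in [set h : H | (N h <= 1)%R /\ L2norm dot mu h <= r%:E]]))%E.

(* r^*(gamma), equal to +oo when no r qualifies. *)
Definition rstar (R : realType) (H : completeNormedModType R)
    (dot : {dot H for @idfun R}) (N : H -> R) (mu : probability (borel H) R)
    (d : measure_display) (Omega : measurableType d) (P : probability Omega R)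
    (n : nat) (X : 'I_n -> {RV P >-> borel H}) (gamma : R) : \bar R :=
  ereal_inf [set r%:E | r in [set r : R |
    0 < r /\ (local_rademacher dot N mu X r <= (gamma * n%:R * r)%:E)%E]].

Definition dual_norm (R : realType) (H : completeNormedModType R)
    (dot : {dot H for @idfun R}) (N : H -> R) (g : H) : \bar R :=
  ereal_sup [set (dot g x)%:E | x in [set x : H | N x <= 1]].

Definition subdifferential (R : realType) (H : completeNormedModType R)
    (dot : {dot H for @idfun R}) (N : H -> R) (hstar : H) : set H :=
  [set g | dual_norm dot N g = 1%E /\ dot g hstar = N hstar].

(* Delta(gamma, h^* ) as a function of r = r^*(gamma); the conventions are
   inf set0 = +oo and sup set0 = -oo. *)
Definition Delta (R : realType) (H : completeNormedModType R)
    (dot : {dot H for @idfun R}) (N : H -> R) (mu : probability (borel H) R)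
    (r : \bar R) (hstar : H) : \bar R :=
  ereal_inf [set ereal_sup [set (dot g h)%:E | g in subdifferential dot N hstar]
            | h in [set h : H | (L2norm dot mu h <= r)%E /\ N h = 1]].

(* Main.v *)
(* Mendelson's small-ball method. Call h on the sphere of L2(mu) admissible when
   r N(h) < 1. With phi the ramp that is 0 below kappa/2 and 1 above kappa, the
   small-ball condition gives E phi(|<X,h>|) >= delta. For finitely many
   admissible h, sup_h sum_i (E phi - phi(|<X_i,h>|)) has mean at most
   n delta/8 up to rounding, by symmetrization, contraction and the definition of
   r, and it concentrates by the bounded-differences method; hence
   sum_i <X_i,h>^2 >= kappa^2 delta n/8 simultaneously for these h with the
   required probability. The mass of the law on a separable set and continuity of
   P extend this to all admissible h. Applied to hhat - hstar, whose products with
   the X_i are the errors, it leaves two cases: the noise bound, or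
   ||<X,hhat - hstar>|| <= r N(hhat - hstar), where N(hhat - hstar) is controlled by
   minimality of hhat against the feasible point hstar + nuhat. *)

Require Import Defs.
From HB Require Import structures.
From mathcomp Require Import all_boot all_order all_algebra.
From mathcomp Require Import sesquilinear ring lra.
From mathcomp Require Import all_classical all_reals all_analysis.
From mathcomp Require Import measurable_realfun.

Set Implicit Arguments.
Unset Strict Implicit.
Unset Printing Implicit Defensive.
Import Order.TTheory GRing.Theory Num.Theory.
Import numFieldNormedType.Exports.

Local Open Scope classical_set_scope.
Local Open Scope ring_scope.

(** * Finite maxima, Rademacher averages and i.i.d. means *)

Definition vmax (R : realType) (m : nat) (A : 'I_m.+1 -> R) : R :=
  \big[Num.max/A ord0]_(j < m.+1) A j.

(* [rad A [:: u1; ...; uk]] is the mean of max_j (A j + sum_i eps_i * ui j) over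
   uniform signs eps. *)
Fixpoint rad (R : realType) (m : nat) (A : 'I_m.+1 -> R)
    (s : seq ('I_m.+1 -> R)) : R :=
  if s is u :: s' then
    (rad (fun j => A j + u j) s' + rad (fun j => A j - u j) s') / 2
  else vmax A.

(** In use, [c] is the vector of expectations of [f], and the offset [A] holds the centred summands
    of the draws already treated, which keeps inductions on the sample going. *)
Definition max_dev (R : realType) (T : Type) (m : nat) (f : T -> 'I_m.+1 -> R)
    (c A : 'I_m.+1 -> R) (s : seq T) : R :=
  vmax (fun j => A j + \sum_(x <- s) (c j - f x j)).

(** For a probability vector [p], the expectation over [n] independent draws, taken one draw at a
    time so that conditioning on the first draw is a mere unfolding. *)
Fixpoint iid_mean (R : realType) (K : finType) (p : K -> R) (n : nat)
    (G : seq K -> R) : R :=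
  if n is n'.+1 then \sum_x p x * iid_mean p n' (fun s => G (x :: s))
  else G [::].

(** * Convexity and contraction of Rademacher averages *)

Section rademacher_averages.
Variables (R : realType) (m : nat).
Implicit Types (A B u : 'I_m.+1 -> R) (s : seq ('I_m.+1 -> R)).

Lemma vmax_ge A j : A j <= vmax A.
Proof. exact: le_bigmax. Qed.

Lemma vmax_le A c : (forall j, A j <= c) -> vmax A <= c.
Proof. by move=> Ac; apply: bigmax_le. Qed.

Lemma vmax_attained A : exists j, vmax A = A j.
Proof.
apply: (big_ind (fun x : R => exists j, x = A j)) => [|x y hx hy|j _].
- by exists ord0.
- by rewrite /Num.max; case: ifP.
- by exists j.
Qed.

Lemma le_vmax A B : (forall j, A j <= B j) -> vmax A <= vmax B.
Proof. by move=> AB; apply: vmax_le => j; exact: le_trans (AB j) (vmax_ge B j). Qed.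

Lemma vmax_shift A c : vmax (fun j => A j + c) = vmax A + c.
Proof.
apply/le_anti/andP; split.
  by apply: vmax_le => j; rewrite lerD2r vmax_ge.
rewrite -lerBrDr; apply: vmax_le => j; rewrite lerBrDr.
exact: (vmax_ge (fun j => A j + c)).
Qed.

Lemma eq_rad A B s : A =1 B -> rad A s = rad B s.
Proof. by move=> /funext ->. Qed.

Lemma le_rad A B s : (forall j, A j <= B j) -> rad A s <= rad B s.
Proof.
elim: s A B => [|u s IH] A B AB /=; first exact: le_vmax.
by rewrite ler_pM2r ?invr_gt0// lerD// IH// => j; rewrite lerD2r.
Qed.

Lemma rad_shift A s c : rad (fun j => A j + c) s = rad A s + c.
Proof.
elim: s A => [|u s IH] A /=; first exact: vmax_shift.
rewrite -(eq_rad s (fun j => addrAC (A j) (u j) c)).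
rewrite -(eq_rad s (fun j => addrAC (A j) (- u j) c)) !IH.
by field.
Qed.

Lemma vmax_jensen (I : finType) (p : I -> R) (B : I -> 'I_m.+1 -> R) :
  (forall i, 0 <= p i) ->
  vmax (fun j => \sum_i p i * B i j) <= \sum_i p i * vmax (B i).
Proof.
move=> p0; apply: vmax_le => j; apply: ler_sum => i _.
by rewrite ler_wpM2l// vmax_ge.
Qed.

(** Convexity in the offset: as the weights sum to 1, each signed shift passes under the average,
    down to the convexity of the maximum. *)
Lemma rad_jensen (I : finType) (p : I -> R) (B : I -> 'I_m.+1 -> R) s :
  (forall i, 0 <= p i) -> \sum_i p i = 1 ->
  rad (fun j => \sum_i p i * B i j) s <= \sum_i p i * rad (B i) s.
Proof.
move=> p0 p1; elim: s B => [|u s IH] B /=; first exact: vmax_jensen.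
have shift v : (fun j => \sum_i p i * B i j + v j) =
    (fun j => \sum_i p i * (B i j + v j)).
  apply/funext => j; under [RHS]eq_bigr do rewrite mulrDr.
  by rewrite big_split/= -mulr_suml p1 mul1r.
rewrite shift (shift (fun j => - u j)).
under eq_bigr do rewrite mulrA mulrDr.
rewrite -mulr_suml big_split/= ler_pM2r ?invr_gt0//.
by rewrite lerD.
Qed.

Lemma rad_midpoint A B s :
  rad (fun j => (A j + B j) / 2) s <= (rad A s + rad B s) / 2.
Proof.
have := @rad_jensen bool (fun=> 2^-1) (fun b => if b then A else B) s.
rewrite !big_bool/= -!mulrDr mulrC => H.
apply: le_trans (H _ _); last 2 first.
- by [].
- by field.
rewrite le_eqVlt; apply/orP; left; apply/eqP/eq_rad => j.
by rewrite big_bool/= mulrC mulrDr.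
Qed.

(** [A] is the midpoint of [A + u] and [A - u], so by convexity centred noise can only raise the
    mean maximum. A zero offset gives nonnegativity. *)
Lemma vmax_le_rad A s : vmax A <= rad A s.
Proof.
elim: s A => [|u s IH] A //=.
apply: le_trans (IH A) _.
have := rad_midpoint (fun j => A j + u j) (fun j => A j - u j) s.
apply: le_trans; rewrite le_eqVlt; apply/orP; left; apply/eqP/eq_rad => j.
by field.
Qed.

(** Contraction for one sign. In the base case fix indices [j] and [k] in the two maxima on the
    left: the sign of [u j - u k] decides which index goes to which maximum on the right. The
    remaining signs only shift [A]. *)
Lemma rad_contraction1 A u v s : (forall j k, v j - v k <= `|u j - u k|) ->
  rad (fun j => A j + v j) s + rad (fun j => A j - v j) s <=
  rad (fun j => A j + u j) s + rad (fun j => A j - u j) s.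
Proof.
move=> vu; elim: s A => [|w s IH] A /=.
  set C := leRHS.
  suff H j k : A j + v j + (A k - v k) <= C.
    rewrite -lerBrDr; apply: vmax_le => j.
    by rewrite lerBrDr addrC -lerBrDr; apply: vmax_le => k; rewrite lerBrDr addrC.
  have := vmax_ge (fun j => A j + u j) j; have := vmax_ge (fun j => A j + u j) k.
  have := vmax_ge (fun j => A j - u j) j; have := vmax_ge (fun j => A j - u j) k.
  rewrite -/C => /=; have := vu j k; rewrite /C.
  by case: (ger0P (u j - u k)); lra.
have sw (a b : 'I_m.+1 -> R) :
    rad (fun j => A j + a j + b j) s = rad (fun j => A j + b j + a j) s.
  by apply: eq_rad => j; rewrite addrAC.
have H1 := IH (fun j => A j + w j); have H2 := IH (fun j => A j - w j).
rewrite (sw v w) (sw v (fun j => - w j)) (sw (fun j => - v j) w).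
rewrite (sw (fun j => - v j) (fun j => - w j)) (sw u w) (sw u (fun j => - w j)).
rewrite (sw (fun j => - u j) w) (sw (fun j => - u j) (fun j => - w j)).
by move: H1 H2; lra.
Qed.

(** The contraction principle, one sign at a time: the tail by induction, then the head by
    [rad_contraction1]. *)
Lemma rad_contraction (phi : R -> R) A s :
  (forall x y, phi x - phi y <= `|x - y|) ->
  rad A [seq phi \o u | u <- s] <= rad A s.
Proof.
move=> lip; elim: s A => [|u s IH] A //=.
rewrite ler_pM2r ?invr_gt0//.
apply: le_trans (lerD (IH _) (IH _)) _.
by apply: rad_contraction1 => j k; exact: lip.
Qed.

(** Each summand costs at most [e] under either sign. This absorbs the rounding of the ramp to a
    grid. *)
Lemma rad_perturb (T : eqType) (f g : T -> 'I_m.+1 -> R) A (s : seq T) (e : R) :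
  (forall x j, x \in s -> `|f x j - g x j| <= e) ->
  rad A (map f s) <= rad A (map g s) + (size s)%:R * e.
Proof.
elim: s A => [|x s IH] A fg /=; first by rewrite mul0r addr0.
have fgs y j : y \in s -> `|f y j - g y j| <= e.
  by move=> ys; apply: fg; rewrite inE ys orbT.
have fgx j : `|f x j - g x j| <= e by apply: fg; rewrite inE eqxx.
have H1 : rad (fun j => A j + f x j) (map g s) <= rad (fun j => A j + g x j) (map g s) + e.
  by rewrite -rad_shift; apply: le_rad => j; have := fgx j; rewrite ler_norml; lra.
have H2 : rad (fun j => A j - f x j) (map g s) <= rad (fun j => A j - g x j) (map g s) + e.
  by rewrite -rad_shift; apply: le_rad => j; have := fgx j; rewrite ler_norml; lra.
have := IH (fun j => A j + f x j) fgs; have := IH (fun j => A j - f x j) fgs.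
by rewrite -[(size s).+1%:R]natr1; move: H1 H2; lra.
Qed.

Lemma radZ c A s : 0 <= c ->
  rad (fun j => c * A j) [seq (fun j => c * u j) | u : 'I_m.+1 -> R <- s] = c * rad A s.
Proof.
move=> c0; elim: s A => [|u s IH] A /=.
  apply/le_anti/andP; split.
    by apply: vmax_le => j; rewrite ler_wpM2l// vmax_ge.
  have [->|cn0] := eqVneq c 0.
    by rewrite mul0r; apply: le_trans (vmax_ge _ ord0); rewrite mul0r.
  have {cn0}c0 : 0 < c by rewrite lt0r cn0.
  rewrite mulrC -ler_pdivlMr//; apply: vmax_le => j; rewrite ler_pdivlMr// mulrC.
  exact: (vmax_ge (fun j => c * A j)).
rewrite -(eq_rad _ (fun j => mulrDr c (A j) (u j))) IH.
rewrite -(eq_rad _ (fun j => mulrBr c (A j) (u j))) IH.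
by field.
Qed.

End rademacher_averages.

(** * Symmetrization and concentration for draws from a finite set *)

Section iid_means.
Variables (R : realType) (K : finType) (p : K -> R).
Hypotheses (p0 : forall x, 0 <= p x) (p1 : \sum_x p x = 1).

Lemma le_iid_mean n (F G : seq K -> R) :
  (forall s, size s = n -> F s <= G s) -> iid_mean p n F <= iid_mean p n G.
Proof.
elim: n F G => [|n IH] F G FG /=; first exact: FG.
apply: ler_sum => x _; apply: ler_wpM2l => //; apply: IH => s sn.
by apply: FG; rewrite /= sn.
Qed.

Lemma iid_meanD n (F G : seq K -> R) :
  iid_mean p n (fun s => F s + G s) = iid_mean p n F + iid_mean p n G.
Proof.
elim: n F G => [//|n IH] F G /=; rewrite -big_split/=.
by apply: eq_bigr => x _; rewrite IH mulrDr.
Qed.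

Lemma iid_meanZ n c (F : seq K -> R) :
  iid_mean p n (fun s => c * F s) = c * iid_mean p n F.
Proof.
elim: n F => [//|n IH] F /=; rewrite big_distrr/=.
by apply: eq_bigr => x _; rewrite IH mulrCA.
Qed.

Lemma iid_mean_cst n c : iid_mean p n (fun=> c) = c.
Proof. by elim: n => [//|n IH] /=; rewrite IH -mulr_suml p1 mul1r. Qed.

(** Fubini for one extra draw, independent of the others. *)
Lemma iid_mean_mix n (F : K -> seq K -> R) :
  \sum_x p x * iid_mean p n (F x) = iid_mean p n (fun s => \sum_x p x * F x s).
Proof.
elim: n F => [//|n IH] F /=; under eq_bigr do rewrite mulr_sumr.
rewrite exchange_big/=; apply: eq_bigr => y _.
by rewrite -IH mulr_sumr; apply: eq_bigr => x _; rewrite mulrCA.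
Qed.

(* Jensen in one coordinate at a time: replacing [m - f x] by the average over an
   independent copy [f x' - f x] turns each centred summand into a signed one. *)
Lemma symmetrization (m n : nat) (f : K -> 'I_m.+1 -> R) (A : 'I_m.+1 -> R) :
  iid_mean p n (max_dev f (fun j => \sum_y p y * f y j) A) <=
  iid_mean p n (fun s => rad A [seq (fun j => 2 * f x j) | x <- s]).
Proof.
elim: n A => [|n IH] A /=.
  by apply: le_vmax => j; rewrite big_nil addr0.
set c := fun j => \sum_y p y * f y j.
(* The first centred summand joins the offset, and the induction hypothesis symmetrizes the
   remaining draws. *)
apply: (@le_trans _ _ (\sum_x p x * iid_mean p n (fun s =>
    rad (fun j => A j + (c j - f x j)) [seq (fun j => 2 * f x j) | x <- s]))).
  apply: ler_sum => x _; rewrite ler_wpM2l//; apply: le_trans (IH _).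
  apply: le_iid_mean => s _; apply: le_vmax => j.
  by rewrite big_cons addrA.
rewrite !iid_mean_mix; apply: le_iid_mean => s _.
set t := map _ s.
(* [c - f x] is the midpoint of [2 * c] and [- 2 * f x], whence the factor 2. Averaging over [x]
   then yields the two signs of [2 * f x]. *)
have step x : rad (fun j => A j + (c j - f x j)) t <=
    (\sum_y p y * rad (fun j => A j + 2 * f y j) t + rad (fun j => A j - 2 * f x j) t) / 2.
  have := rad_midpoint (fun j => \sum_y p y * (A j + 2 * f y j)) (fun j => A j - 2 * f x j) t.
  rewrite (@eq_rad _ _ _ (fun j => A j + (c j - f x j))); last first.
    move=> j; under eq_bigr do rewrite mulrDr mulrCA.
    by rewrite big_split/= -mulr_suml p1 -mulr_sumr -/(c j); field.
  move/le_trans; apply; rewrite ler_pM2r ?invr_gt0// lerD2r.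
  exact: rad_jensen.
apply: le_trans (ler_sum _ (fun x _ => ler_wpM2l (p0 x) (step x))) _.
under eq_bigr do rewrite mulrA mulrDr.
rewrite -mulr_suml big_split/= -mulr_suml p1 mul1r.
under [leRHS]eq_bigr do rewrite mulrA mulrDr.
by rewrite -mulr_suml big_split.
Qed.

(** [1 - u <= expR (- u)] bounds [expR u] by 1/(1 - u), and (1 - u)(1 + u + 2u^2) = 1 + u^2(1 - 2u)
    is at least 1 in this range. *)
Lemma expR_le_quad (u : R) : u <= 1 / 2 -> expR u <= 1 + u + 2 * u ^+ 2.
Proof.
move=> u2; have h : 1 - u <= expR (- u) by exact: expR_ge1Dx.
have h0 : 0 < 1 - u by lra.
rewrite -[u in expR u]opprK expRN -[leRHS]invrK lef_pV2 ?posrE ?expR_gt0//; last first.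
  by rewrite invr_gt0; have := sqr_ge0 (u + 1/2); nra.
apply: le_trans h; rewrite -[leRHS]invrK lef_pV2 ?posrE ?invr_gt0//; last first.
  by have := sqr_ge0 (u + 1/2); nra.
rewrite -[leLHS]div1r ler_pdivrMr//.
by have := sqr_ge0 u; nra.
Qed.

(** The factor 2 of [expR_le_quad] times the largest variance 1/4 of a variable in a unit interval
    gives [l ^+ 2 / 2]. The range of [l] keeps the centred exponent at most 1/2. *)
Lemma hoeffding_unit (g : K -> R) (a l : R) :
  (forall x, a <= g x <= a + 1) -> 0 <= l <= 1 / 2 ->
  \sum_x p x * expR (l * g x) <= expR (l * (\sum_x p x * g x) + l ^+ 2 / 2).
Proof.
move=> gab /andP[l0 l2]; set c := \sum_x p x * g x.
pose q := \sum_x p x * (g x - a).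
have cq : c = q + a.
  rewrite /q; under eq_bigr do rewrite mulrBr.
  by rewrite sumrB -mulr_suml p1 mul1r subrK.
have q0 : 0 <= q.
  by apply: sumr_ge0 => x _; rewrite mulr_ge0// subr_ge0; case/andP: (gab x).
have q1 : q <= 1.
  rewrite -p1; apply: ler_sum => x _; rewrite ler_piMr//.
  by have := gab x; lra.
have b x : l * (g x - c) <= 1 / 2 by have := gab x; nra.
apply: (@le_trans _ _ (\sum_x p x * (expR (l * c) *
    (1 + l * (g x - c) + 2 * (l * (g x - c)) ^+ 2)))).
  apply: ler_sum => x _; rewrite ler_wpM2l//.
  rewrite [in leLHS](_ : l * g x = l * c + l * (g x - c)); last by ring.
  by rewrite expRD ler_wpM2l ?expR_ge0// expR_le_quad.
rewrite expRD; under eq_bigr do rewrite mulrCA.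
rewrite -mulr_sumr ler_wpM2l ?expR_ge0//.
apply: le_trans (expR_ge1Dx _).
(* Var g <= q - q^2 <= 1/4 *)
apply: (@le_trans _ _ (\sum_x (p x * (1 - l * (c - a) + 2 * l ^+ 2 * (q ^+ 2)) +
    p x * (g x - a) * (l + 2 * l ^+ 2 * (1 - 2 * q))))).
  apply: ler_sum => x _; rewrite -[X in _ <= _ + X]mulrA -mulrDr ler_wpM2l//.
  rewrite cq; have /andP[ga gb] := gab x.
  (* [g x - a] lies in [0, 1], so its square is at most itself; this makes the majorant affine in
     [g x - a]. *)
  have : 0 <= l ^+ 2 * ((g x - a) * (1 - (g x - a))).
    by rewrite mulr_ge0 ?sqr_ge0// mulr_ge0; lra.
  by rewrite !expr2; lra.
rewrite big_split/= -!mulr_suml p1 -/q cq.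
have : 0 <= l ^+ 2 * (q - 1/2) ^+ 2 by rewrite mulr_ge0 ?sqr_ge0.
by rewrite !expr2; lra.
Qed.

(** Bounded differences by conditioning on the first draw: its conditional mean [g x] stays in a
    unit interval, so every draw costs one application of [hoeffding_unit]. *)
Lemma iid_mean_exp_vmax (m n : nat) (f : K -> 'I_m.+1 -> R) (c A : 'I_m.+1 -> R) (l : R) :
  (forall x j, 0 <= f x j <= 1) -> 0 <= l <= 1 / 2 ->
  iid_mean p n (fun s => expR (l * max_dev f c A s)) <=
  expR (l * iid_mean p n (max_dev f c A) + n%:R * (l ^+ 2 / 2)).
Proof.
move=> f01 l01; set Z := max_dev f c; elim: n A => [|n IH] A /=.
  by rewrite mul0r addr0.
pose g x := iid_mean p n (Z (fun j => A j + (c j - f x j))).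
have Zc B x s : Z B (x :: s) = Z (fun j => B j + (c j - f x j)) s.
  rewrite /Z /max_dev; congr vmax; apply/funext => j.
  by rewrite big_cons addrA.
under eq_bigr => x _ do under [X in iid_mean p n X]eq_fun do rewrite Zc.
under [in leRHS]eq_bigr => x _ do under [X in iid_mean p n X]eq_fun do rewrite Zc.
apply: (@le_trans _ _ (\sum_x p x * (expR (l * g x) * expR (n%:R * (l ^+ 2 / 2))))).
  by apply: ler_sum => x _; rewrite ler_wpM2l// -expRD IH.
rewrite [leLHS](_ : _ = (\sum_x p x * expR (l * g x)) * expR (n%:R * (l ^+ 2 / 2))); last first.
  by rewrite mulr_suml; apply: eq_bigr => x _; rewrite mulrA.
rewrite [X in _ <= expR X](_ : _ = l * (\sum_x p x * g x) + l ^+ 2 / 2 + n%:R * (l ^+ 2 / 2)); last first.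
  by rewrite -[n.+1%:R]natr1; ring.
rewrite [leRHS]expRD ler_pM2r ?expR_gt0//.
(* The lower end replaces [f x j] by its largest value 1; replacing it by 0 instead raises the
   maximum by exactly 1. *)
apply: (@hoeffding_unit g (iid_mean p n (Z (fun j => A j + c j - 1)))) => // x.
apply/andP; split.
  apply: le_iid_mean => s _.
  by apply: le_vmax => j; have := f01 x j; lra.
rewrite -[X in _ + X](iid_mean_cst n 1) -iid_meanD; apply: le_iid_mean => s _.
by rewrite /Z /max_dev -vmax_shift; apply: le_vmax => j; have := f01 x j; lra.
Qed.

(** Chernoff: the indicator of [a <= Z s] is at most [expR (l * (Z s - a))]. *)
Lemma iid_mean_tail (n : nat) (Z : seq K -> R) (l a : R) : 0 <= l ->
  iid_mean p n (fun s => (a <= Z s)%R%:R) <=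
  expR (- (l * a)) * iid_mean p n (fun s => expR (l * Z s)).
Proof.
move=> l0; rewrite -iid_meanZ; apply: le_iid_mean => s _.
rewrite -expRD; have [aZ|_] := lerP a (Z s); last exact: expR_ge0.
apply: le_trans (expR_ge1Dx _).
by rewrite lerDl addrC -mulrBr mulr_ge0// subr_ge0.
Qed.

End iid_means.

(** * Recursive means as sums over finite functions *)

Section sums_over_ffun.
Variables (V : nmodType) (K : finType).

Definition fcons n (x : K) (g : {ffun 'I_n -> K}) : {ffun 'I_n.+1 -> K} :=
  [ffun i => oapp g x (unlift ord0 i)].

Lemma fcons0 n x (g : {ffun 'I_n -> K}) : fcons x g ord0 = x.
Proof. by rewrite ffunE unlift_none. Qed.

Lemma fconsS n x (g : {ffun 'I_n -> K}) i : fcons x g (lift ord0 i) = g i.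
Proof. by rewrite ffunE liftK. Qed.

Lemma map_fcons n x (g : {ffun 'I_n -> K}) :
  map (fcons x g) (enum 'I_n.+1) = x :: map g (enum 'I_n).
Proof.
rewrite enum_ordSl /= fcons0 -map_comp; congr cons.
by apply: eq_map => i /=; rewrite fconsS.
Qed.

Lemma sum_ffunS n (F : {ffun 'I_n.+1 -> K} -> V) :
  \sum_f F f = \sum_x \sum_g F (fcons x g).
Proof.
rewrite pair_big/= (reindex (fun u : K * {ffun 'I_n -> K} => fcons u.1 u.2))//.
exists (fun f : {ffun 'I_n.+1 -> K} =>
  (f ord0, [ffun i : 'I_n => f (lift ord0 i)])) => [[x g] _|f _] /=.
  by rewrite fcons0; congr pair; apply/ffunP => i; rewrite ffunE fconsS.
by apply/ffunP => i; rewrite ffunE; case: unliftP => [j ->|->] /=; rewrite ?ffunE.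
Qed.

Lemma sum_ffun0 (F : {ffun 'I_0 -> K} -> V) (g : {ffun 'I_0 -> K}) :
  \sum_f F f = F g.
Proof.
rewrite (big_pred1 g)// => f; apply/esym/eqP/ffunP.
by case.
Qed.

End sums_over_ffun.

Lemma iid_mean_ffun (R : realType) (K : finType) (p : K -> R) n (G : seq K -> R) :
  iid_mean p n G =
  \sum_(t : {ffun 'I_n -> K}) (\prod_i p (t i)) * G (map t (enum 'I_n)).
Proof.
elim: n G => [|n IH] G /=.
  rewrite (@sum_ffun0 _ _ _ (ffun0 (card_ord 0))) big_ord0 mul1r.
  by congr G; apply/esym/size0nil; rewrite size_map size_enum_ord.
rewrite sum_ffunS; apply: eq_bigr => x _; rewrite IH mulr_sumr.
apply: eq_bigr => g _; rewrite map_fcons big_ord_recl fcons0 mulrA.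
by under [in RHS]eq_bigr do rewrite fconsS.
Qed.

(** Links the recursion to the sign vectors of [rademacher_mean]; the first sign is absorbed by the
    offset. *)
Lemma rad_ffun (R : realType) (m n : nat) (u : 'I_n -> 'I_m.+1 -> R) A :
  rad A (map u (enum 'I_n)) =
  2 ^- n * \sum_(s : {ffun 'I_n -> bool})
    vmax (fun j => A j + \sum_i (-1) ^+ s i * u i j).
Proof.
elim: n u A => [|n IH] u A /=.
  rewrite (@sum_ffun0 _ _ _ (ffun0 (card_ord 0))) expr0 invr1 mul1r.
  rewrite (size0nil (s := enum _)) ?size_enum_ord//=; congr vmax.
  by apply/funext => j; rewrite big_ord0 addr0.
rewrite enum_ordSl /= -map_comp sum_ffunS big_bool/= !IH.
have E (b : bool) : \sum_g vmax (fun j => A j + \sum_i (-1) ^+ fcons b g i * u i j) =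
    \sum_(g : {ffun 'I_n -> bool})
      vmax (fun j => A j + (-1) ^+ b * u ord0 j + \sum_i (-1) ^+ g i * u (lift ord0 i) j).
  apply: eq_bigr => g _; congr vmax; apply/funext => j.
  rewrite big_ord_recl fcons0 addrA; congr (_ + _).
  by apply: eq_bigr => i _; rewrite fconsS.
rewrite !E exprS invfM -mulrDr [LHS]mulrC mulrA addrC.
congr (2^-1 * _ * (_ + _)); apply: eq_bigr => g _; congr vmax;
  by apply/funext => j; rewrite ?expr1 ?expr0 ?mulN1r ?mul1r.
Qed.

(** * Law of a discretized i.i.d. sample *)

Section law_of_iid_sample.
Variables (R : realType) (d d' : measure_display).
Variables (Omega : measurableType d) (T : measurableType d').
Variables (P : probability Omega R) (mu : probability T R).
Variables (n : nat) (X : 'I_n -> {RV P >-> T}).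
Hypotheses (idX : identically_distributed mu X) (indX : mutually_independent X).
Variables (K : finType) (pi : T -> K).
Hypothesis mpi : forall k, measurable (pi @^-1` [set k]).

Definition pmf (k : K) : R := fine (mu (pi @^-1` [set k])).

Lemma pmf_ge0 k : 0 <= pmf k.
Proof. exact: fine_ge0. Qed.

Lemma measure_pmf (Q : pred K) :
  mu (pi @^-1` [set` Q]) = (\sum_(k | Q k) pmf k)%:E.
Proof.
have -> : pi @^-1` [set` Q] = \bigcup_(k in [set` Q]) pi @^-1` [set k].
  by apply/seteqP; split => [x Qx|x [k Qk /= ->]]//; exists (pi x).
rewrite measure_fin_bigcup//.
- rewrite -(bigfs _ (r := index_enum K)) ?index_enum_uniq//; last first.
    by move=> k _; rewrite mem_index_enum.
  by rewrite -sumEFin; apply: eq_bigr => k _; rewrite fineK// fin_num_measure.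
- by move=> i j _ _ [x [/= <- <-]].
Qed.

Lemma pmf_sum1 : \sum_k pmf k = 1.
Proof.
apply: EFin_inj; rewrite -(measure_pmf predT) -(probability_setT mu).
by congr (mu _); apply/seteqP; split.
Qed.

Let A (t : {ffun 'I_n -> K}) : set Omega :=
  \bigcap_(i in [set` [set: 'I_n]%SET]) (X i @^-1` (pi @^-1` [set t i])).

Let mA t : measurable (A t).
Proof.
apply: fin_bigcap_measurable => [|i _]; first exact: finite_finset.
exact: measurable_funPTI.
Qed.

Lemma measurable_sample (b : pred (seq K)) :
  measurable [set w | b (map (fun i => pi (X i w)) (enum 'I_n))].
Proof.
rewrite [X in measurable X](_ : _ =
    \bigcup_(t in [set t : {ffun 'I_n -> K} | b (map t (enum 'I_n))]) A t).
  by apply: fin_bigcup_measurable => [|t _]; [exact: finite_finset|exact: mA].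
apply/seteqP; split => [w /= bw|w [t /= bt At]].
  exists [ffun i => pi (X i w)]; last by move=> i _; rewrite /= ffunE.
  by rewrite /= (eq_map (g := fun i => pi (X i w)))// => i; rewrite ffunE.
rewrite (eq_map (g := t))// => i.
by apply: (At i); rewrite /= finset.in_setT.
Qed.

(** The sets [A t] partition [Omega], the integrand is constant on each, and their probabilities
    factor by independence. *)
Lemma integral_iid_mean (G : seq K -> R) : (forall s, 0 <= G s) ->
  (\int[P]_w (G (map (fun i => pi (X i w)) (enum 'I_n)))%:E)%E =
  (iid_mean pmf n G)%:E.
Proof.
move=> G0; rewrite iid_mean_ffun.
have PA t : P (A t) = (\prod_i pmf (t i))%:E.
  rewrite indX//.
  rewrite -prodEFin; apply: eq_big => [i|i _]; first by rewrite finset.in_setT.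
  by rewrite -[LHS]/(distribution P (X i) _) idX// fineK// fin_num_measure.
transitivity (\int[P]_w (\sum_(t : {ffun 'I_n -> K})
    ((G (map t (enum 'I_n)))%:E * (\1_(A t) w)%:E)))%E.
  apply: eq_integral => w _.
  pose t := [ffun i => pi (X i w)].
  rewrite (bigD1 t)//= big1 ?adde0.
    rewrite indicE mem_set ?mule1; last by move=> i _; rewrite /= ffunE.
    by congr (G _)%:E; apply: eq_map => i; rewrite ffunE.
  move=> s st; rewrite indicE memNset ?mule0// => Aw; case/eqP: st.
  by apply/ffunP => i; rewrite ffunE; apply/esym/(Aw i); rewrite /= finset.in_setT.
rewrite ge0_integral_sum//; last 2 first.
- move=> t; apply: measurable_funeM; exact/measurable_EFinP/measurable_indic.
- by move=> t w _; rewrite mule_ge0// ?lee_fin.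
rewrite -sumEFin; apply: eq_bigr => t _.
rewrite ge0_integralZl ?lee_fin//; last exact/measurable_EFinP/measurable_indic.
rewrite integral_indic// setIT EFinM muleC; congr (_ * _)%E; exact: PA.
Qed.

Lemma probability_iid_mean (b : pred (seq K)) :
  P [set w | b (map (fun i => pi (X i w)) (enum 'I_n))] =
  (iid_mean pmf n (fun s => (b s)%:R))%:E.
Proof.
rewrite -integral_iid_mean; last by move=> s; case: (b s).
set E := [set w | _].
have -> : (fun w => ((b (map (fun i => pi (X i w)) (enum 'I_n)))%:R)%:E) =
    (fun w => (\1_E w)%:E) :> (Omega -> \bar R).
  apply/funext => w; rewrite indicE; congr (nat_of_bool _)%:R%:E.
  by apply/idP/idP; rewrite inE.
by rewrite integral_indic ?setIT//; exact: measurable_sample.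
Qed.

End law_of_iid_sample.

(** * Inner product and L2 norm *)

Section hilbert_space.
Variables (R : realType) (H : completeNormedModType R) (dot : {dot H for @idfun R}).

Lemma dotC u v : dot u v = dot v u.
Proof. by rewrite hermC expr0 mul1r. Qed.

Lemma dotDr u v w : dot u (v + w) = dot u v + dot u w.
Proof. exact: linearDr. Qed.

Lemma dotZr u a v : dot u (a *: v) = a * dot u v.
Proof. exact: linearZr_LR. Qed.

Lemma dotBl u v w : dot (u - v) w = dot u w - dot v w.
Proof. exact: linearBl. Qed.

Lemma dotDl u v w : dot (u + v) w = dot u w + dot v w.
Proof. exact: linearDl. Qed.

Lemma dotBr u v w : dot w (u - v) = dot w u - dot w v.
Proof. exact: linearBr. Qed.

Hypothesis dotE : dot_induces_norm dot.

Lemma dot_polarization x h : dot x h = (`|x + h| ^+ 2 - `|x - h| ^+ 2) / 4.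
Proof.
rewrite !dotE !dotBl !dotBr !dotDl !dotDr (dotC h x).
by field.
Qed.

Lemma normr_dot_le x h : `|dot x h| <= `|x| * (`|x| + `|h|).
Proof.
rewrite dot_polarization.
have n1 : `|x + h| <= `|x| + `|h| by exact: ler_normD.
have n2 : `|x - h| <= `|x| + `|h| by exact: ler_normB.
have n3 : `|x + h| - `|x - h| <= 2 * `|x|.
  rewrite lerBlDr (_ : x + h = (x + x) - (x - h)); last by rewrite opprB addrACA subrr addr0.
  by apply: le_trans (ler_normB _ _) _; rewrite lerD2r; apply: le_trans (ler_normD _ _) _; lra.
have n4 : `|x - h| - `|x + h| <= 2 * `|x|.
  rewrite lerBlDr (_ : x - h = (x + x) - (x + h)); last by rewrite opprD addrACA subrr add0r.
  by apply: le_trans (ler_normB _ _) _; rewrite lerD2r; apply: le_trans (ler_normD _ _) _; lra.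
have := normr_ge0 (x + h); have := normr_ge0 (x - h).
by rewrite ler_norml; have := normr_ge0 x; nra.
Qed.

Lemma continuous_dot (h : H) : continuous (fun x : H => dot x h).
Proof.
rewrite (_ : (fun x : H => dot x h) =
    (fun x : H => (`|x + h| * `|x + h| - `|x - h| * `|x - h|) * 4^-1)); last first.
  by apply/funext => x; rewrite dot_polarization !expr2.
move=> x; apply: cvgMr_tmp; apply: cvgB; apply: cvgM; apply: cvg_norm;
  by apply: cvgD; [exact: cvg_id|exact: cvg_cst].
Qed.

Lemma measurable_dot (h : H) : measurable_fun setT (fun x : borel H => dot x h).
Proof.
apply: (measurability _ (RGenOInfty.measurableE R)) => _ [_ [a ->] <-].
rewrite setTI; apply: sub_gen_smallest.
rewrite set_itvE; apply: (open_comp _ (@open_gt _ a)) => x _.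
exact: continuous_dot.
Qed.

Variable mu : probability (borel H) R.

Local Notation L2 := (L2norm dot mu).

Lemma L2norm_ge0 h : (0 <= L2 h)%E.
Proof. exact: Lnorm_ge0. Qed.

Lemma L2normZ a h : L2 (a *: h) = (`|a|%:E * L2 h)%E.
Proof.
rewrite /L2norm unlock.
have E x : (`|(dot x (a *: h))%:E| `^ 2 = (`|a| `^ 2)%:E * `|(dot x h)%:E| `^ 2)%E.
  by rewrite dotZr EFinM abseM poweRM.
under eq_integral do rewrite E.
rewrite ge0_integralZl//; last 2 first.
- apply: (measurableT_comp (measurable_poweR 2)).
  apply: (measurableT_comp (@abse_measurable R setT)).
  apply: (measurableT_comp (@EFin_measurable R setT)).
  exact: measurable_dot.
- by move=> x _; rewrite poweR_ge0.
rewrite poweRM ?lee_fin ?powR_ge0//; last first.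
  by apply: integral_ge0 => x _; rewrite poweR_ge0.
by rewrite -poweR_EFin -poweRrM mulfV// poweRe1.
Qed.

Lemma L2norm0 : L2 0 = 0%E.
Proof. by rewrite -(scale0r (0 : H)) L2normZ normr0 mul0e. Qed.

Lemma L2norm_fin (kappa delta : R) h : 0 < kappa -> 0 < delta ->
  small_ball dot mu kappa delta -> L2 h \is a fin_num.
Proof.
move=> k0 d0 /(_ h); rewrite ge0_fin_numE ?L2norm_ge0// ltey.
apply: contraTN => /eqP ->; rewrite gt0_muley ?lte_fin//.
rewrite (_ : [set x | _] = set0) ?measure0 -?ltNge ?lte_fin//.
by apply/seteqP; split.
Qed.

Lemma small_ball_sphere (kappa delta : R) h : small_ball dot mu kappa delta ->
  L2 h = 1%E -> (delta%:E <= mu [set x : borel H | (kappa <= `|dot x h|)%R])%E.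
Proof.
by move=> /(_ h) + h1; rewrite h1 mule1.
Qed.

(** At 0 the small-ball event is the whole space. *)
Lemma small_ball_le1 (kappa delta : R) :
  small_ball dot mu kappa delta -> delta <= 1.
Proof.
move=> /(_ 0); rewrite -lee_fin L2norm0 mule0 (_ : [set x | _] = setT).
  by rewrite probability_setT.
by apply/seteqP; split => // x _ /=; rewrite lee_fin.
Qed.

End hilbert_space.

(** The integral of a nonnegative function is a supremum over the simple functions below it, hence
    monotone for arbitrary integrands, such as the suprema in [local_rademacher]. *)
Lemma ge0_le_integral_lower (R : realType) d (T : measurableType d)
    (mu : {measure set T -> \bar R}) (f g : T -> \bar R) :
  (forall x, 0 <= f x)%E -> (forall x, f x <= g x)%E ->
  (\int[mu]_x f x <= \int[mu]_x g x)%E.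
Proof.
move=> f0 fg; rewrite !ge0_integralTE//; last by move=> x; exact: le_trans (fg x).
by apply: le_ereal_sup => _ [h /= hf <-]; exists h => //= x; exact: le_trans (fg x).
Qed.

(** A Lipschitz function between two indicators: that of absolute value at least [kappa] below it,
    to use the small-ball condition, and that of at least [kappa / 2] above it, to bound squares. *)
Definition ramp (R : realType) (kappa t : R) : R :=
  Num.max 0 (Num.min 1 (2 / kappa * `|t| - 1)).

Section ramp.
Variables (R : realType) (kappa : R).
Hypothesis kappa_gt0 : 0 < kappa.
Local Notation phi := (ramp kappa).

Lemma ramp_ge0 t : 0 <= phi t.
Proof. by rewrite /ramp le_max lexx. Qed.

Lemma ramp_le1 t : phi t <= 1.
Proof. by rewrite /ramp ge_max ler01 ge_min lexx. Qed.

Lemma ramp1 t : kappa <= `|t| -> phi t = 1.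
Proof.
move=> kt; have : 2 <= 2 / kappa * `|t|.
  by rewrite mulrAC ler_pdivlMr// ler_pM2l.
move=> h; rewrite /ramp min_l; last by lra.
by rewrite max_r.
Qed.

Lemma ramp_lip s t : phi s - phi t <= 2 / kappa * `|s - t|.
Proof.
have k0 : 0 <= 2 / kappa by rewrite divr_ge0// ltW.
have : 2 / kappa * `|s| - 2 / kappa * `|t| <= 2 / kappa * `|s - t|.
  by rewrite -mulrBr ler_wpM2l// lerB_dist.
have : 0 <= 2 / kappa * `|s - t| by rewrite mulr_ge0.
rewrite /ramp; set a := 2 / kappa * `|s|; set b := _ * `|t|; set c := _ * `|s - t|.
rewrite !maxEle !minEle.
by case: ifPn; case: ifPn; case: ifPn; case: ifPn; rewrite -?ltNge; lra.
Qed.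

Lemma ramp_le_sqr t : kappa ^+ 2 / 4 * phi t <= t ^+ 2.
Proof.
have [tk|kt] := leP (2 * `|t|) kappa.
  rewrite /ramp max_l ?mulr0 ?sqr_ge0// ge_min; apply/orP; right.
  by rewrite subr_le0 mulrAC ler_pdivrMr// mul1r.
apply: (@le_trans _ _ (kappa ^+ 2 / 4)).
  by rewrite ler_piMr ?ramp_le1// divr_ge0// sqr_ge0.
rewrite -(real_normK (num_real t)) !expr2; set u := `|t|.
have : 0 <= (2 * u - kappa) * (2 * u + kappa).
  by rewrite mulr_ge0 ?subr_ge0 ?addr_ge0 ?mulr_ge0 ?normr_ge0// ltW.
lra.
Qed.

Lemma measurable_ramp : measurable_fun setT phi.
Proof.
apply: measurable_maxr; first exact: measurable_cst.
apply: measurable_minr; first exact: measurable_cst.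
apply: measurable_funB; last exact: measurable_cst.
by apply: measurable_funM; [exact: measurable_cst|exact: normr_measurable].
Qed.

End ramp.

(** * Small-ball lower bound for finitely many vectors *)

Section finite_family.
Variables (R : realType) (H : completeNormedModType R).
Variables (dot : {dot H for @idfun R}) (N : H -> R) (mu : probability (borel H) R).
Variables (d : measure_display) (Omega : measurableType d).
Variables (P : probability Omega R) (n : nat) (X : 'I_n -> {RV P >-> borel H}).
Variables (kappa delta r0 : R) (m : nat) (h : 'I_m.+1 -> H) (M : nat).
Hypotheses (dotE : dot_induces_norm dot) (NH : is_norm N).
Hypotheses (idX : identically_distributed mu X) (indX : mutually_independent X).
Hypotheses (k0 : 0 < kappa) (d0 : 0 < delta) (sb : small_ball dot mu kappa delta).
Hypotheses (r00 : 0 < r0) (M0 : (0 < M)%N) (Md : 100 <= delta * M%:R).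
Hypothesis rad_r0 :
  (local_rademacher dot N mu X r0 <= (kappa * delta / 32 * n%:R * r0)%:E)%E.
Hypotheses (h1 : forall j, L2norm dot mu (h j) = 1%E) (hN : forall j, r0 * N (h j) <= 1).

(* Rounding [ramp kappa (dot x (h j))] down to multiples of 1/M makes the sample
   take finitely many values, so that all expectations become finite sums. *)
Let K : finType := {ffun 'I_m.+1 -> 'I_M.+1}.
Let phi j (x : borel H) : R := ramp kappa (dot x (h j)).
Let cell (x : borel H) : K := [ffun j => inord (Num.truncn (M%:R * phi j x))].
Let lvl (k : K) (j : 'I_m.+1) : R := (k j : nat)%:R / M%:R.

Let Mgt0 : 0 < M%:R :> R.
Proof. by rewrite ltr0n. Qed.

Let lvl_cell x j : lvl (cell x) j = (Num.truncn (M%:R * phi j x))%:R / M%:R.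
Proof.
rewrite /lvl ffunE inordK// ltnS truncn_le_nat -natr1.
by rewrite ltr_pwDr// ler_piMr ?ler0n// ramp_le1.
Qed.

Let Mphi_ge0 j x : 0 <= M%:R * phi j x.
Proof. by rewrite mulr_ge0// ?ler0n// ramp_ge0. Qed.

Let lvl01 k j : 0 <= lvl k j <= 1.
Proof.
rewrite /lvl divr_ge0 ?ler0n//= ler_pdivrMr// mul1r ler_nat.
by rewrite -ltnS ltn_ord.
Qed.

Let lvl_le x j : lvl (cell x) j <= phi j x.
Proof.
rewrite lvl_cell ler_pdivrMr// [leRHS]mulrC.
by have /andP[] := truncn_itv (Mphi_ge0 j x).
Qed.

Let lvl_ge x j : phi j x - M%:R^-1 <= lvl (cell x) j.
Proof.
rewrite lvl_cell ler_pdivlMr// mulrBl mulVf ?gt_eqF// lerBlDr natr1 [leLHS]mulrC ltW//.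
by have /andP[] := truncn_itv (Mphi_ge0 j x).
Qed.

Let measurable_phi j : measurable_fun setT (phi j).
Proof.
apply: (measurableT_comp (@measurable_ramp _ kappa)).
exact: measurable_dot.
Qed.

Let measurable_cell k : measurable (cell @^-1` [set k]).
Proof.
rewrite [X in measurable X](_ : _ = \bigcap_(j in [set: 'I_m.+1])
    ((fun x => M%:R * phi j x) @^-1` `[(k j)%:R, (k j).+1%:R[%classic)); last first.
  apply/seteqP; split => [x /= xk j _|x /= xk].
    rewrite /= in_itv/= -truncn_eq//; apply/eqP.
    rewrite -xk ffunE inordK// ltnS truncn_le_nat -natr1.
    by rewrite ltr_pwDr// ler_piMr ?ler0n// ramp_le1.
  apply/ffunP => j; rewrite ffunE; apply/ord_inj.
  have := xk j Logic.I; rewrite /= in_itv/= -truncn_eq// => /eqP ->.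
  by rewrite inordK.
apply: fin_bigcap_measurable => [|j _]; first exact: finite_finset.
have mf : measurable_fun setT (fun x => M%:R * phi j x).
  by apply: measurable_funM; [exact: measurable_cst|exact: measurable_phi].
by rewrite -[X in measurable X]setTI; apply: mf => //; exact: measurable_itv.
Qed.

Let p := pmf mu cell.
Let c j := \sum_k p k * lvl k j.
Let smp w := map (fun i => cell (X i w)) (enum 'I_n).

Let c_ge j : delta <= c j.
Proof.
rewrite -lee_fin; apply: (le_trans (small_ball_sphere sb (h1 j))).
(* Where the ramp equals 1 the rounding is exact, so the small-ball event lies in the top level. *)
have cellE x : kappa <= `|dot x (h j)| -> cell x j = ord_max.
  move=> kx; apply/ord_inj; rewrite ffunE /phi ramp1// mulr1.
  by rewrite [Num.truncn _]natrK inordK.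
apply: (@le_trans _ _ (mu (cell @^-1` [set` [pred k : K | k j == ord_max]]))).
  apply: le_measure; rewrite ?inE.
  - rewrite -[X in measurable X]setTI.
    have mf := measurableT_comp (@normr_measurable R setT) (measurable_dot dotE (h j)).
    rewrite (_ : [set x | _] = (Num.Def.normr \o (fun x : borel H => dot x (h j))) @^-1` `[kappa, +oo[%classic).
      by apply: mf => //; exact: measurable_itv.
    by apply/seteqP; split => x /=; rewrite in_itv/= andbT.
  - rewrite (_ : cell @^-1` _ = \bigcup_(k in [set` [pred k : K | k j == ord_max]])
        cell @^-1` [set k]).
      by apply: fin_bigcup_measurable => [|k _]; [exact: finite_finset|exact: measurable_cell].
    by apply/seteqP; split => [x ?|x [k ? /= ->]]//; exists (cell x).
  - by move=> x /cellE cx; apply/eqP.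
rewrite measure_pmf//.
rewrite lee_fin /c [leRHS](bigID (fun k : K => k j == ord_max))/=.
rewrite -[leLHS]addr0 lerD//; last first.
  apply: sumr_ge0 => k _; rewrite mulr_ge0 ?pmf_ge0//; by case/andP: (lvl01 k j).
by apply: ler_sum => k /eqP kj; rewrite /lvl kj /= mulfV ?gt_eqF// mulr1.
Qed.

Let G s : R := rad (fun=> 0) [seq (fun j => 2 * lvl k j) | k <- s].

Let u w i j : R := r0 * dot (X i w) (h j).

Let G_le w : G (smp w) <=
  4 / (kappa * r0) * rad (fun=> 0) (map (u w) (enum 'I_n)) + n%:R * (2 / M%:R).
Proof.
rewrite /G /smp -map_comp.
apply: (@le_trans _ _ (rad (fun=> 0) (map (fun i j => 2 * phi j (X i w)) (enum 'I_n)) +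
    n%:R * (2 / M%:R))).
  rewrite -[n in n%:R * _]size_enum_ord; apply: rad_perturb => i j _ /=.
  rewrite -mulrBr normrM ger0_norm// ler_pM2l// distrC ger0_norm ?subr_ge0//.
  by rewrite lerBlDr -lerBlDl.
rewrite lerD2r.
have k4 : 0 <= 4 / (kappa * r0) by rewrite divr_ge0// mulr_ge0// ltW.
rewrite -radZ// -map_comp mulr0.
(* The slopes multiply to 2 * (2 / kappa) * (kappa / 4) = 1, and the factor [4 / (kappa * r0)]
   applied to [u] cancels both [kappa / 4] and [r0]. *)
pose psi t := 2 * ramp kappa (kappa / 4 * t).
have psi_lip s t : psi s - psi t <= `|s - t|.
  rewrite /psi -mulrBr.
  apply: le_trans (ler_wpM2l _ (ramp_lip k0 _ _)) _ => //.
  rewrite -mulrBr normrM gtr0_norm ?divr_gt0//.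
  rewrite le_eqVlt; apply/orP; left; apply/eqP; field.
  by rewrite gt_eqF.
have := rad_contraction (fun=> 0) (map ((fun v j => 4 / (kappa * r0) * v j) \o u w) (enum 'I_n)) psi_lip.
rewrite -map_comp; apply: le_trans.
rewrite le_eqVlt; apply/orP; left; apply/eqP; congr (rad _ _).
apply: eq_map => i /=; apply/funext => j /=.
rewrite /psi /phi /u; congr (2 * ramp _ _).
by field; rewrite !gt_eqF.
Qed.

Let rad_le w : ((rad (fun=> 0) (map (u w) (enum 'I_n)))%:E <=
  rademacher_mean (fun eps : 'I_n -> R =>
     ereal_sup [set (\sum_(i < n) eps i * dot (X i w) h)%R%:E |
                h in [set h : H | (N h <= 1)%R /\ L2norm dot mu h <= r0%:E]]))%E.
Proof.
rewrite rad_ffun /rademacher_mean EFinM lee_pmul2l ?lte_fin ?invr_gt0 ?exprn_gt0//.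
rewrite -sumEFin; apply: lee_sum => s _.
set S := ereal_sup _.
have key j : ((0 + \sum_i (-1) ^+ s i * u w i j)%:E <= S)%E.
  (* This vector has L2 norm [r0] and, by [hN], lies in the unit ball of [N]. *)
  apply: ereal_sup_ubound; exists (r0 *: h j); last first.
    rewrite add0r; congr EFin; apply: eq_bigr => i _.
    by rewrite dotZr mulrCA.
  by rewrite /= (norm_homogeneous NH) L2normZ// h1 mule1 gtr0_norm.
have [j ->] := vmax_attained (fun j => 0 + \sum_i (-1) ^+ s i * u w i j).
exact: key.
Qed.

Let mean_G : iid_mean p n G <= n%:R * (delta / 8 + 2 / M%:R).
Proof.
pose c4 := 4 / (kappa * r0).
have c40 : 0 < c4 by rewrite divr_gt0// mulr_gt0.
(* The positive part provides the nonnegativity asked by [integral_iid_mean]; it stays below the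
   Rademacher average, which is nonnegative. *)
pose G' s := c4^-1 * Num.max 0 (G s - n%:R * (2 / M%:R)).
have G'0 s : 0 <= G' s by rewrite mulr_ge0 ?invr_ge0 ?(ltW c40)// le_max lexx.
have : iid_mean p n G' <= kappa * delta / 32 * n%:R * r0.
  rewrite -lee_fin -(integral_iid_mean idX indX measurable_cell G'0).
  apply: le_trans rad_r0; apply: ge0_le_integral_lower => w; first by rewrite lee_fin.
  apply: le_trans (rad_le w); rewrite lee_fin /G' ler_pdivrMl//.
  rewrite ge_max; apply/andP; split.
    rewrite mulr_ge0 ?(ltW c40)//.
    by apply: le_trans (vmax_le_rad _ _); apply: (vmax_ge (fun=> 0) ord0).
  by rewrite lerBlDr; exact: G_le.
move=> hG'.
apply: (@le_trans _ _ (c4 * iid_mean p n G' + n%:R * (2 / M%:R))).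
  rewrite -iid_meanZ -[X in _ + X](@iid_mean_cst _ _ p _ n)//; last first.
    exact: pmf_sum1.
  rewrite -iid_meanD; apply: le_iid_mean => [k|s _]; first exact: pmf_ge0.
  by rewrite /G' mulVKf ?gt_eqF// -lerBlDr le_max lexx orbT.
rewrite mulrDr lerD2r.
(* The constant 32 of gamma becomes 8 here, through the factor 4 in [c4]. *)
apply: le_trans (ler_wpM2l (ltW c40) hG') _; rewrite /c4.
rewrite le_eqVlt; apply/orP; left; apply/eqP; field.
by rewrite !gt_eqF.
Qed.

Let Z := max_dev lvl c (fun=> 0).

Let mean_Z : iid_mean p n Z <= n%:R * (delta / 8 + delta / 50).
Proof.
apply: le_trans (symmetrization _ _ _ _ _) _.
- by move=> k; exact: pmf_ge0.
- exact: pmf_sum1.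
apply: le_trans mean_G _; rewrite ler_wpM2l ?ler0n// lerD2l.
by rewrite ler_pdivrMr//; have := Md; lra.
Qed.

Let tail_Z : iid_mean p n (fun s => (n%:R * delta / 2 <= Z s)%R%:R) <=
  expR (- (delta ^+ 2 * n%:R / 16)).
Proof.
(* With 71/200 = 1/2 - 1/8 - 1/50 this [l] minimizes the Chernoff exponent, whose value is
   -(71/200)^2/2 times [delta ^+ 2 * n%:R]. That factor is about 0.063, just above 1/16, which is
   why the rounding term is kept to 1/50. *)
pose l := 71 / 200 * delta.
have d1 := small_ball_le1 dotE sb.
have p0 k : 0 <= p k by exact: pmf_ge0.
have p1 : \sum_k p k = 1 by exact: pmf_sum1.
have l01 : 0 <= l <= 1 / 2 by rewrite /l; have := d0; have := d1; lra.
have l0 : 0 <= l by case/andP: l01.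
apply: le_trans (iid_mean_tail p0 n Z _ l0) _.
have H1 := iid_mean_exp_vmax p0 p1 n c (fun=> 0) lvl01 l01.
apply: le_trans (ler_wpM2l (expR_ge0 _) H1) _.
rewrite -expRD ler_expR.
have : l * iid_mean p n Z <= l * (n%:R * (delta / 8 + delta / 50)) by rewrite ler_wpM2l.
have : 0 <= n%:R * delta ^+ 2 by rewrite mulr_ge0 ?ler0n ?sqr_ge0.
by rewrite /l -/Z !expr2; lra.
Qed.

Lemma finite_family_lower_bound :
  ((1 - 2 * expR (- (delta ^+ 2 * n%:R / 16)))%:E <=
   P [set w | forall j, (kappa ^+ 2 * delta / 8 * n%:R <=
      \sum_(i < n) dot (X i w) (h j) ^+ 2)%R])%E.
Proof.
pose bad s := n%:R * delta / 2 <= Z s.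
have mbad : measurable [set w | bad (smp w)].
  exact: (measurable_sample X measurable_cell).
have Pbad : P [set w | bad (smp w)] = (iid_mean p n (fun s => (bad s)%:R))%:E.
  exact: (probability_iid_mean idX indX measurable_cell).
apply: (@le_trans _ _ (P (~` [set w | bad (smp w)]))).
  rewrite probability_setC// Pbad -EFinB lee_fin lerD2l lerN2.
  apply: le_trans tail_Z _; rewrite ler_peMl ?expR_ge0//.
  by rewrite ler1n.
apply: le_measure; rewrite ?inE.
- exact: measurableC.
- rewrite (_ : [set w | _] = \bigcap_(j in [set: 'I_m.+1]) (fun w =>
      \sum_(i < n) dot (X i w) (h j) ^+ 2) @^-1` `[kappa ^+ 2 * delta / 8 * n%:R, +oo[%classic).
    apply: fin_bigcap_measurable => [|j _]; first exact: finite_finset.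
    rewrite -[X in measurable X]setTI.
    have mf : measurable_fun setT (fun w => \sum_(i < n) dot (X i w) (h j) ^+ 2).
      apply: measurable_sum => i; apply: measurable_funX.
      apply: (measurableT_comp (measurable_dot dotE (h j))).
      exact: measurable_funPT.
    by apply: mf => //; exact: measurable_itv.
  apply/seteqP; split => w /= hw j; first by move=> _ /=; rewrite in_itv/= andbT.
  by have := hw j Logic.I; rewrite /= in_itv/= andbT.
move=> w /= /negP; rewrite /bad -ltNge => Zlt j.
have k2 : 0 < kappa ^+ 2 / 4 by rewrite divr_gt0// exprn_gt0.
(* Since [Z] is below [n%:R * delta / 2], this leaves at least half of [n%:R * delta] for the
   squares divided by [kappa ^+ 2 / 4]. *)
suff : \sum_(i < n) (delta - (kappa ^+ 2 / 4)^-1 * dot (X i w) (h j) ^+ 2) <= Z (smp w).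
  rewrite sumrB -mulr_sumr sumr_const card_ord -mulr_natr.
  set S := \sum_i _ => hS.
  have : (kappa ^+ 2 / 4)^-1 * S >= n%:R * delta / 2 by move: hS Zlt; lra.
  rewrite ler_pdivlMl//; lra.
apply: le_trans (vmax_ge _ j); rewrite add0r big_map big_enum/=.
apply: ler_sum => i _; rewrite lerB ?c_ge//.
apply: le_trans (lvl_le _ _) _.
by rewrite ler_pdivlMl//; exact: ramp_le_sqr.
Qed.

End finite_family.

(** Indices not hit by the injection get the default [x0], hence an inclusion, which also covers an
    empty [D]. *)
Lemma countable_enum (T : choiceType) (x0 : T) (D : set T) : countable D ->
  exists d : nat -> T, D `<=` range d.
Proof.
move=> /countable_injP[f finj].
exists (fun k => xget x0 [set x | D x /\ f x = k]) => x Dx.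
exists (f x) => //; case: xgetP => [y -> [Dy fy]|/(_ x)/not_andP[]//].
by apply: finj => //; rewrite inE.
Qed.

Section norms.
Variables (R : realType) (H : lmodType R) (N : H -> R).
Hypothesis NH : is_norm N.

Lemma is_norm0 : N 0 = 0.
Proof. by rewrite -(scale0r (0 : H)) (norm_homogeneous NH) normr0 mul0r. Qed.

Lemma is_normN x : N (- x) = N x.
Proof. by rewrite -scaleN1r (norm_homogeneous NH) normrN1 mul1r. Qed.

Lemma is_norm_ge0 x : 0 <= N x.
Proof. by have := norm_triangle NH x (- x); rewrite subrr is_norm0 is_normN; lra. Qed.

Lemma is_norm_gt0 x : x != 0 -> 0 < N x.
Proof.
move=> x0; rewrite lt_neqAle is_norm_ge0 andbT eq_sym.
by apply: contra x0 => /eqP /(norm_definite NH) ->.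
Qed.

End norms.

(** * Countable approximation through inner products *)

Section separability.
Variables (R : realType) (H : completeNormedModType R).
Variable dot : {dot H for @idfun R}.
Hypothesis dotE : dot_induces_norm dot.

(* The index (k, q, m) records a bound on the norm and the integer parts of
   m.+1 * dot (d j) h for the first points d j of the dense set. *)
Lemma countable_approx (D S : set H) : countable D -> S !=set0 ->
  exists c : nat -> H, (forall t, S (c t)) /\
    forall n (x : 'I_n -> H) (h : H) (e : R), (forall i, closure D (x i)) -> S h -> 0 < e ->
      exists t, forall i, `|dot (x i) h - dot (x i) (c t)| <= e.
Proof.
move=> /(countable_enum 0)[d dD] [h0 Sh0].
pose A (u : nat * nat * seq int) : set H := [set h | [/\ S h, `|h| <= u.1.1%:R &
  forall j, (j < size u.2)%N ->
    `|u.1.2.+1%:R * dot (d j) h - (nth 0 u.2 j)%:~R| <= 1]].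
(* An index whose set [A] is empty yields [h0], so the sequence never leaves [S]. *)
pose c t := xget h0 (A (odflt (0%N, 0%N, [::]) (unpickle t))).
exists c; split=> [t|n x h e Dx Sh e0]; first by rewrite /c; case: xgetP => // y _ [].
pose k := (Num.truncn `|h|).+1.
have hk : `|h| <= k%:R by apply: ltW; exact: truncnS_gt.
(* Chosen so that [eta * (1 + 2 * k%:R) <= e / 2], where [2 * k%:R] bounds the distance between two
   vectors of norm at most [k%:R]. *)
pose eta := Num.min 1 (e / 2 / (1 + 2 * k%:R)).
have k2 : 0 < 1 + 2 * k%:R :> R by have := ler0n R k; lra.
have eta0 : 0 < eta by rewrite /eta lt_min ltr01 !divr_gt0.
have near i : exists j, `|x i - d j| < eta.
  have [y [Dy]] := Dx i _ (nbhsx_ballx (x i) eta eta0).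
  by rewrite -ball_normE /= => xy; have [j _ dj] := dD _ Dy; exists j; rewrite dj.
pose J i := xchoose (near i).
have JP i : `|x i - d (J i)| < eta by exact: (xchooseP (near i)).
pose L := (\max_i J i).+1.
(* Two values sharing an integer part after scaling by [m.+1] differ by at most [2 / m.+1%:R], here
   at most [e / 2]. *)
pose m := Num.truncn (4 / e).
have me : 2 / m.+1%:R <= e / 2.
  rewrite ler_pdivrMr ?ltr0n//.
  have := truncnS_gt (4 / e); rewrite -/m ltr_pdivrMr// => /ltW.
  by set M := m.+1%:R; lra.
pose q := mkseq (fun j => Num.floor (m.+1%:R * dot (d j) h)) L.
pose u := (k, m, q).
have Ah : A u h.
  split => // j; rewrite [size _]size_mkseq => jL; rewrite [nth _ _ _]nth_mkseq//=.
  by set z := _ * _; have := floor_itv z; rewrite intrD ler_norml; lra.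
exists (pickle u) => i.
set g := c _.
have [_ h'k h'q] : A u g.
  by rewrite /g /c pickleK /=; case: xgetP => [y -> //|/(_ h)/(_ Ah)].
have [_ _ hq] := Ah.
have jL : (J i < size q)%N by rewrite size_mkseq ltnS (leq_bigmax i).
have Hd : `|dot (d (J i)) h - dot (d (J i)) g| <= 2 / m.+1%:R.
  rewrite ler_pdivlMr ?ltr0n// -[m.+1%:R]ger0_norm ?ler0n// -normrM.
  have := hq _ jL; have := h'q _ jL; rewrite /= !ler_norml mulrBl.
  rewrite ![_ * dot _ _]mulrC; lra.
have -> : dot (x i) h - dot (x i) g =
    dot (x i - d (J i)) (h - g) + (dot (d (J i)) h - dot (d (J i)) g).
  by rewrite dotBl !dotBr; ring.
apply: le_trans (ler_normD _ _) _.
have : `|dot (x i - d (J i)) (h - g)| <= e / 2.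
  apply: le_trans (normr_dot_le dotE _ _) _.
  have hg : `|h - g| <= 2 * k%:R by apply: le_trans (ler_normB _ _) _; move: h'k => /=; lra.
  have := JP i; have : eta <= 1 by rewrite /eta ge_min lexx.
  have : eta * (1 + 2 * k%:R) <= e / 2.
    by rewrite -ler_pdivlMr// /eta ge_min lexx orbT.
  have := normr_ge0 (x i - d (J i)); have := normr_ge0 (h - g).
  by nra.
by have := le_trans Hd me; lra.
Qed.

End separability.

(** * Lower bound over all admissible vectors *)

Section uniform_lower_bound.
Variables (R : realType) (H : completeNormedModType R).
Variables (dot : {dot H for @idfun R}) (N : H -> R) (mu : probability (borel H) R).
Variables (d : measure_display) (Omega : measurableType d).
Variables (P : probability Omega R) (n : nat) (X : 'I_n -> {RV P >-> borel H}).
Variables (kappa delta : R).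
Hypotheses (dotE : dot_induces_norm dot) (NH : is_norm N).
Hypotheses (sep : separable_law mu).
Hypotheses (idX : identically_distributed mu X) (indX : mutually_independent X).
Hypotheses (k0 : 0 < kappa) (d0 : 0 < delta) (sb : small_ball dot mu kappa delta).

Local Notation r := (rstar dot N mu X (kappa * delta / 32)).
Local Notation L2 := (L2norm dot mu).

Let S : set H := [set h | L2 h = 1%E /\ (r * (N h)%:E < 1)%E].
Let lb : R := kappa ^+ 2 * delta / 8 * n%:R.

Let admissible (r0 : R) : Prop := 0 < r0 /\
  (local_rademacher dot N mu X r0 <= (kappa * delta / 32 * n%:R * r0)%:E)%E.

(** The strict inequality puts [r] below the inverse of [N h], so some radius of the set defining
    [rstar] fits in between, whether or not the infimum is attained. *)
Let S_admissible h : S h -> exists2 r0, admissible r0 & r0 * N h <= 1.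
Proof.
move=> [h1 rh].
have Nh : 0 < N h.
  apply: is_norm_gt0 => //; apply/eqP => h0.
  by move: h1; rewrite h0 L2norm0// => /eqP; rewrite eqe eq_sym oner_eq0.
have : (r < ((N h)^-1)%:E)%E.
  case: r rh => [r||] rh; [|by move: rh; rewrite gt0_mulye ?lte_fin|exact: ltNyr].
  by move: rh; rewrite -EFinM !lte_fin -ltr_pdivlMr// div1r.
move=> /ereal_inf_lt[_ [r0 /= adm <-]]; rewrite lte_fin => r0N.
by exists r0 => //; rewrite -ler_pdivlMr// div1r ltW.
Qed.

(** The least of finitely many admissible radii is one of them, and it satisfies all the constraints
    because [N] is nonnegative. *)
Let S_admissible_seq (c : nat -> H) m : (forall t, S (c t)) ->
  exists2 r0, admissible r0 & forall j : 'I_m.+1, r0 * N (c j) <= 1.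
Proof.
move=> Sc; elim: m => [|m [r0 adm0 h0]].
  have [r0 adm h] := S_admissible (Sc 0%N).
  by exists r0 => // j; rewrite ord1.
have [r1 adm1 h1] := S_admissible (Sc m.+1).
exists (Num.min r0 r1); first by rewrite /Num.min; case: ifP.
move=> j; have [jm|] := ltnP j m.+1.
  apply: le_trans (h0 (Ordinal jm)); rewrite ler_wpM2r ?is_norm_ge0//.
  by rewrite ge_min lexx.
rewrite leq_eqVlt ltnNge -ltnS ltn_ord orbF => /eqP <-.
apply: le_trans h1; rewrite ler_wpM2r ?is_norm_ge0//.
by rewrite ge_min lexx orbT.
Qed.

Let good (h : H) : set Omega := [set w | lb <= \sum_(i < n) dot (X i w) h ^+ 2].

Let measurable_good h : measurable (good h).
Proof.
have mf : measurable_fun setT (fun w => \sum_(i < n) dot (X i w) h ^+ 2).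
  apply: measurable_sum => i; apply: measurable_funX.
  apply: (measurableT_comp (measurable_dot dotE h)).
  exact: measurable_funPT.
rewrite (_ : good h = setT `&` (fun w => \sum_(i < n) dot (X i w) h ^+ 2) @^-1` `[lb, +oo[%classic).
  by apply: mf => //; exact: measurable_itv.
by rewrite setTI; apply/seteqP; split => w /=; rewrite in_itv/= andbT.
Qed.

Let probability_good_prefix (c : nat -> H) m : (forall t, S (c t)) ->
  ((1 - 2 * expR (- (delta ^+ 2 * n%:R / 16)))%:E <=
   P (\bigcap_(t in [set t | (t <= m)%N]) good (c t)))%E.
Proof.
move=> Sc; have [r0 [r00 rad] rN] := S_admissible_seq m Sc.
pose M := (Num.truncn (100 / delta)).+1.
have Md : 100 <= delta * M%:R.
  by rewrite mulrC -ler_pdivrMr// ltW// truncnS_gt.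
have := @finite_family_lower_bound R H dot N mu d Omega P n X kappa delta r0 m
  (fun j => c j) M dotE NH idX indX k0 d0 sb r00 isT Md rad (fun j => (Sc j).1) rN.
move=> /le_trans; apply; rewrite le_eqVlt; apply/orP; left; apply/eqP.
congr (P _); apply/seteqP; split => w /= hw; last by move=> j; apply: hw; rewrite /= -ltnS.
by move=> t; rewrite /= -ltnS => tm; exact: (hw (Ordinal tm)).
Qed.

Lemma uniform_lower_bound : exists E : set Omega,
  [/\ measurable E,
      ((1 - 2 * expR (- (delta ^+ 2 * n%:R / 16)))%:E <= P E)%E &
      forall w h, E w -> L2 h = 1%E -> (r * (N h)%:E < 1)%E ->
        kappa ^+ 2 * delta / 8 * n%:R <= \sum_(i < n) dot (X i w) h ^+ 2].
Proof.
have [S0|] := eqVneq S set0.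
  exists setT; split => //.
    rewrite probability_setT lee_fin gerDl oppr_le0 mulr_ge0// expR_ge0//.
  by move=> w h _ h1 hr; have : S h by []; rewrite S0.
move=> /set0P S0; have [D Dc D1] := sep.
have [c [Sc cS]] := countable_approx dotE Dc S0.
have mD : measurable (closure D : set (borel H)).
  rewrite -[closure D]setCK; apply: measurableC; apply: sub_gen_smallest.
  by rewrite openC; exact: closed_closure.
(* [E1] is the lower bound along the approximating sequence; [E2], of probability 1, places the
   sample in the closure of [D], where the approximation applies. *)
pose E1 := \bigcap_t good (c t).
pose E2 := \bigcap_(i in [set` [set: 'I_n]%SET]) (X i @^-1` closure D).
have mE1 : measurable E1 by exact: bigcap_measurableType.
have mE2 : measurable E2.
  apply: fin_bigcap_measurable => [|i _]; first exact: finite_finset.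
  exact: measurable_funPTI.
have PE2 : P E2 = 1%E.
  rewrite indX// big1// => i _.
  by rewrite -[LHS]/(distribution P (X i) _) idX.
have PE1 : ((1 - 2 * expR (- (delta ^+ 2 * n%:R / 16)))%:E <= P E1)%E.
  (* Each prefix obeys the bound with the same constant; continuity from above passes it to the
     intersection. *)
  pose F m := \bigcap_(t in [set t | (t <= m)%N]) good (c t).
  have mF m : measurable (F m) by exact: bigcap_measurableType.
  have FE : \bigcap_m F m = E1.
    apply/seteqP; split => w hw t _; first exact: (hw t Logic.I t (leqnn t)).
    by move=> s _; exact: hw.
  have := @nonincreasing_cvg_mu _ _ _ P F _ mF _ _.
  rewrite FE => cvgF.
  apply: (closed_cvg _ (@closed_ereal_le_ereal R _) _ (P E1) (cvgF _ mE1 _)).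
  - by apply: nearW => m; exact: probability_good_prefix.
  - by apply: le_lt_trans (probability_le1 P (mF 0%N)) _; exact: ltry.
  - move=> a b ab; apply/subsetPset => w Fw t /= ta.
    by apply: Fw; exact: leq_trans ab.
exists (E1 `&` E2); split.
- exact: measurableI.
- apply: (le_trans PE1).
  apply: (@le_trans _ _ (P ((E1 `&` E2) `|` ~` E2))).
    apply: le_measure; rewrite ?inE//.
      by apply: measurableU; [exact: measurableI|exact: measurableC].
    by move=> w E1w; have [E2w|] := pselect (E2 w); [left|right].
  apply: le_trans (measureU2 _ _ _) _; [exact: measurableI|exact: measurableC|].
  rewrite [X in (_ + X <= _)%E](_ : _ = 0%E) ?adde0//.
  by have := probability_setC P mE2; rewrite PE2 subee.
move=> w h [E1w E2w] h1 rh; rewrite leNgt; apply/negP => lt.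
pose b i := dot (X i w) h.
pose B := \sum_(i < n) (2 * `|b i| + 1).
have B0 : 0 <= B by apply: sumr_ge0 => i _; rewrite addr_ge0// mulr_ge0.
set A := \sum_(i < n) _ in lt.
pose e := Num.min 1 ((lb - A) / 2 / (B + 1)).
have AL : 0 < lb - A by rewrite subr_gt0.
have e0 : 0 < e by rewrite /e lt_min ltr01 !divr_gt0//; lra.
have e1 : e <= 1 by rewrite /e ge_min lexx.
have eB : e * (B + 1) <= (lb - A) / 2.
  by rewrite -ler_pdivlMr ?/e ?ge_min ?lexx ?orbT//; lra.
have Dx i : closure D (X i w) by apply: (E2w i); rewrite /= finset.in_setT.
have [t ct] := cS _ _ h e Dx (conj h1 rh) e0.
have : \sum_(i < n) dot (X i w) (c t) ^+ 2 <= A + e * B.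
  rewrite mulr_sumr -big_split/=; apply: ler_sum => i _.
  have := ct i; rewrite -/(b i) -(real_normK (num_real (dot _ (c t)))).
  rewrite -[b i ^+ 2](real_normK (num_real (b i))) => bt.
  have : `|dot (X i w) (c t)| <= `|b i| + e.
    by have := lerB_dist (dot (X i w) (c t)) (b i); rewrite distrC; lra.
  have := normr_ge0 (dot (X i w) (c t)); have := normr_ge0 (b i).
  by rewrite !expr2; nra.
have := E1w t Logic.I; rewrite /good/= -/lb.
by move: eB AL; nra.
Qed.

End uniform_lower_bound.

Lemma rstar_ge0 (R : realType) (H : completeNormedModType R)
    (dot : {dot H for @idfun R}) (N : H -> R) (mu : probability (borel H) R)
    (d : measure_display) (Omega : measurableType d) (P : probability Omega R)
    (n : nat) (X : 'I_n -> {RV P >-> borel H}) (gamma : R) :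
  (0 <= rstar dot N mu X gamma)%E.
Proof. by apply: le_ereal_inf_tmp => _ [r [r0 _] <-]; rewrite lee_fin ltW. Qed.

(** * Deterministic consequences of the lower bound *)

Section deterministic_part.
Variables (R : realType) (H : completeNormedModType R).
Variables (dot : {dot H for @idfun R}) (N : H -> R) (mu : probability (borel H) R).
Hypotheses (dotE : dot_induces_norm dot) (NH : is_norm N).
Variable r : \bar R.
Hypothesis r0 : (0 <= r)%E.
Local Notation L2 := (L2norm dot mu).

(** Dividing [h] by its L2 norm [s] makes it admissible, and the lower bound then compares [s ^+ 2]
    with the sum of the squared errors. *)
Lemma L2norm_le_noise (kappa delta : R) (n : nat) (x : 'I_n -> H) (xi : 'I_n -> R) (h : H) :
  0 < kappa -> 0 < delta -> (0 < n)%N -> L2 h \is a fin_num ->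
  (forall h, L2 h = 1%E -> (r * (N h)%:E < 1)%E ->
     kappa ^+ 2 * delta / 8 * n%:R <= \sum_(i < n) dot (x i) h ^+ 2) ->
  (forall i, dot (x i) h = xi i) -> (r * (N h)%:E < L2 h)%E ->
  (L2 h <= (Num.sqrt 8 / (kappa * Num.sqrt delta) *
            (euclidean_norm xi / Num.sqrt n%:R))%:E)%E.
Proof.
move=> k0 d0 n0 hfin good xih rh.
have : (0 < L2 h)%E by apply: le_lt_trans rh; rewrite mule_ge0// lee_fin is_norm_ge0.
rewrite -(fineK hfin); set s := fine _; rewrite lte_fin => s0.
have L1 : L2 (s^-1 *: h) = 1%E.
  by rewrite L2normZ// gtr0_norm ?invr_gt0// -(fineK hfin) -EFinM mulVf ?gt_eqF.
have rs : (r * (N (s^-1 *: h))%:E < 1)%E.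
  rewrite (norm_homogeneous NH) gtr0_norm ?invr_gt0// mulrC EFinM muleA.
  move: rh; rewrite -(fineK hfin) -/s.
  case: (r * _)%E => [t|//|]; last by move=> _; rewrite gt0_mulNye ?lte_fin ?invr_gt0// ltNyr.
  by rewrite -EFinM !lte_fin ltr_pdivrMr// mul1r.
have := good _ L1 rs.
have -> : \sum_(i < n) dot (x i) (s^-1 *: h) ^+ 2 = s^-1 ^+ 2 * \sum_(i < n) xi i ^+ 2.
  by rewrite mulr_sumr; apply: eq_bigr => i _; rewrite dotZr exprMn xih.
rewrite exprVn ler_pdivlMl ?exprn_gt0// => hs.
have nR : 0 < n%:R :> R by rewrite ltr0n.
rewrite lee_fin /euclidean_norm -(ler_pXn2r (n := 2))// ?nnegrE ?(ltW s0)//; last first.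
  by rewrite mulr_ge0// divr_ge0 ?sqrtr_ge0// mulr_ge0 ?sqrtr_ge0// ltW.
rewrite !exprMn !exprVn exprMn !sqr_sqrtr ?ler0n ?(ltW d0)//; last first.
  by apply: sumr_ge0 => i _; exact: sqr_ge0.
move: hs; set Q := \sum_(i < n) _ => hs.
rewrite (_ : _ * (Q / _) = Q / (kappa ^+ 2 * delta / 8 * n%:R)); last first.
  by field; rewrite !gt_eqF.
by rewrite ler_pdivlMr// mulr_gt0// divr_gt0// mulr_gt0// exprn_gt0.
Qed.

Lemma dot_le_norm (g y : H) : dual_norm dot N g = 1%E -> dot g y <= N y.
Proof.
move=> g1; have [->|y0] := eqVneq y 0.
  by rewrite (is_norm0 NH) [leLHS]linear0r.
have Ny := is_norm_gt0 NH y0.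
have : ((dot g ((N y)^-1 *: y))%:E <= dual_norm dot N g)%E.
  apply: ereal_sup_ubound; exists ((N y)^-1 *: y) => //=.
  by rewrite (norm_homogeneous NH) gtr0_norm ?invr_gt0// mulVf ?gt_eqF.
by rewrite g1 lee_fin dotZr ler_pdivrMl// mulr1.
Qed.

(** A subgradient [g] at [hstar] satisfies [dot g (hstar + h) <= N (hstar + h)], so [dot g h <= b].
    Normalizing [h] by [N h] gives a competitor in [Delta], whence [zeta <= b / N h]. *)
Lemma norm_le_of_Delta (hstar h : H) (zeta b : R) : 0 < zeta ->
  (zeta%:E <= Delta dot N mu r hstar)%E -> (L2 h <= r * (N h)%:E)%E ->
  N (hstar + h) <= N hstar + b -> 0 <= b -> N h <= b / zeta.
Proof.
move=> z0 zD hr hb b0; have [->|h0] := eqVneq h 0.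
  by rewrite (is_norm0 NH) divr_ge0// ltW.
have Nh := is_norm_gt0 NH h0.
have Hr : (L2 ((N h)^-1 *: h) <= r)%E.
  rewrite L2normZ// gtr0_norm ?invr_gt0//.
  apply: le_trans (lee_wpmul2l _ hr) _; first by rewrite lee_fin invr_ge0 ltW.
  by rewrite muleCA -EFinM mulVf ?gt_eqF// mule1.
have N1 : N ((N h)^-1 *: h) = 1.
  by rewrite (norm_homogeneous NH) gtr0_norm ?invr_gt0// mulVf ?gt_eqF.
have : (zeta%:E <= (b / N h)%:E)%E.
  apply: le_trans zD _.
  apply: (@le_trans _ _ (ereal_sup [set (dot g ((N h)^-1 *: h))%:E |
      g in subdifferential dot N hstar])).
    by apply: ereal_inf_lbound; exists ((N h)^-1 *: h).
  apply: ge_ereal_sup => _ [g [g1 gh] <-].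
  rewrite lee_fin dotZr mulrC ler_pM2r ?invr_gt0//.
  have := dot_le_norm (hstar + h) g1; rewrite dotDr gh.
  by move: hb; lra.
by rewrite lee_fin !ler_pdivlMr// mulrC.
Qed.

End deterministic_part.

Theorem theorem2p1 (R : realType) (H : completeNormedModType R)
    (dot : {dot H for @idfun R}) (N : H -> R)
    (d : measure_display) (Omega : measurableType d) (P : probability Omega R)
    (mu : probability (borel H) R) (n : nat)
    (X : 'I_n -> {RV P >-> borel H}) (xi Y : 'I_n -> Omega -> R) (hstar : H)
    (hhat nuhat : Omega -> H) (kappa delta : R) :
  dot_induces_norm dot ->
  is_norm N ->
  separable_law mu ->
  identically_distributed mu X ->
  mutually_independent X ->
  (forall i w, Y i w = dot (X i w) hstar + xi i w) ->
  (forall w, is_min_norm_solution dot N (fun i => X i w) (fun i => Y i w)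
               (hhat w)) ->
  (forall w, is_min_norm_solution dot N (fun i => X i w) (fun i => xi i w)
               (nuhat w)) ->
  0 < kappa -> 0 < delta ->
  small_ball dot mu kappa delta ->
  let gamma := kappa * delta / 32 in
  let r := rstar dot N mu X gamma in
  let noise w := Num.sqrt 8 / (kappa * Num.sqrt delta)
                 * (euclidean_norm (fun i => xi i w) / Num.sqrt n%:R) in
  exists E : set Omega,
    [/\ measurable E,
        ((1 - 2 * expR (- (delta ^+ 2 * n%:R / 16)))%:E <= P E)%E,
        (forall w, E w ->
           (L2norm dot mu (hhat w - hstar)%R <=
             maxe (noise w)%:E (r * (2 * N hstar + N (nuhat w))%:E))%E) &
        (forall zeta : R, 0 < zeta ->
           (zeta%:E <= Delta dot N mu r hstar)%E ->
           forall w, E w ->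
           (L2norm dot mu (hhat w - hstar)%R <=
             maxe (noise w)%:E (r * (N (nuhat w) / zeta)%:E))%E)].
Proof.
move=> dotE NH sep idX indX YE hhatP nuhatP k0 d0 sb gamma r noise.
have r0 : (0 <= r)%E by exact: rstar_ge0.
(* For an empty sample the required probability is at least -1 only, so the empty event will do. *)
have [n0|n0] := posnP n.
  exists set0; split=> //.
  rewrite measure0 lee_fin n0 mulr0 mul0r oppr0 expR0; lra.
have [E [mE PE goodE]] := uniform_lower_bound dotE NH sep idX indX k0 d0 sb.
have Lfin h := L2norm_fin h k0 d0 sb.
have xih w i : dot (X i w) (hhat w - hstar) = xi i w.
  by rewrite dotBr (hhatP w).1 YE addrC addKr.
have dich w : E w -> (L2norm dot mu (hhat w - hstar)%R <= (noise w)%:E)%E \/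
    (L2norm dot mu (hhat w - hstar)%R <= r * (N (hhat w - hstar))%:E)%E.
  move=> Ew; have [|rh] := leP (L2norm dot mu (hhat w - hstar)) (r * (N (hhat w - hstar))%:E)%E.
    by right.
  left; apply: (L2norm_le_noise dotE NH r0 k0 d0 n0 (Lfin _) _ (xih w) rh) => h.
  exact: goodE Ew.
(* [hstar + nuhat w] interpolates the observations, so it competes with [hhat w]. *)
have Nhhat w : N (hhat w) <= N hstar + N (nuhat w).
  apply: le_trans (norm_triangle NH _ _); apply: (hhatP w).2 => i.
  by rewrite dotDr (nuhatP w).1 YE.
(* The event is fixed before [zeta], so both bounds share it; they differ only in the estimate of
   [N (hhat w - hstar)]. *)
exists E; split=> // [w Ew|zeta z0 zD w Ew]; rewrite le_max.
  have [->//|h] := dich w Ew; apply/orP; right; apply: (le_trans h).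
  apply: lee_wpmul2l => //; rewrite lee_fin.
  have := norm_triangle NH (hhat w) (- hstar); rewrite (is_normN NH).
  by have := Nhhat w; lra.
have [->//|h] := dich w Ew; apply/orP; right; apply: (le_trans h).
apply: lee_wpmul2l => //; rewrite lee_fin.
apply: (norm_le_of_Delta dotE NH z0 zD h _ (is_norm_ge0 NH _)).
by rewrite addrC subrK.
Qed.
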